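(* Let $\mathbf a,\mathbf b,\mathbf c$ be three distinct non-collinear oriented cycles. Let $\mathbf n_a\in\mathcal G(\mathbf b,\mathbf c)$, $\mathbf n_b\in\mathcal G(\mathbf a,\mathbf c)$, $\mathbf n_c\in\mathcal G(\mathbf a,\mathbf b)$ be three generalized cycles distinct from $\mathbf a,\mathbf b,\mathbf c$. Then $\mathbf n_a,\mathbf n_b,\mathbf n_c$ are collinear if and only if $$(\mathbf b,\mathbf c;\mathbf n_a)\,(\mathbf c,\mathbf a;\mathbf n_b)\,(\mathbf a,\mathbf b;\mathbf n_c)=1.$$ Moreover, when this holds and $\mathbf n_a,\mathbf n_b$ are elliptic (with any chosen orientations), then $$(\mathbf n_a,\mathbf n_b;\mathbf n_c)=(\mathbf n_a,\mathbf c;\mathbf b)\,(\mathbf c,\mathbf n_b;\mathbf a).$$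
   Context: The Möbius plane is $\mathbb C\cup\{\infty\}$. A (non-oriented) cycle is the solution set of $kz\bar z+lz+m\bar z+n=0$ with $M=\left(\begin{smallmatrix} k & l \\ m & n \end{smallmatrix}\right)$ a $2\times2$ Hermitian matrix of negative determinant, i.e. a Euclidean circle or a straight line with $\infty$ attached; $M$ is determined up to a nonzero real factor. An oriented cycle corresponds to a unique normalized Hermitian matrix $M$ with $\det M=-1$, the sign being chosen so that the left half-plane of the oriented cycle is $\{kz\bar z+lz+m\bar z+n<0\}$; reversing orientation replaces $M$ by $-M$. A generalized cycle is a nonzero $2\times2$ Hermitian matrix considered up to a nonzero real factor. It is elliptic (an ordinary cycle) if its determinant is negative, parabolic if the determinant is zero, hyperbolic (virtual) if the determinant is positive. Oriented cycles are identified with their underlying generalized cycles when orientation is irrelevant. For two generalized cycles that are distinct (non-proportional matrices $M,N$), the extended pencil $\mathcal G(\cdot,\cdot)$ they define is the set of all generalized cycles with matrix $xM+yN$, $(x,y)\in\mathbb R^2\setminus\{0\}$. Three generalized cycles are collinear if they belong to one extended pencil, i.e. their matrices are linearly dependent over $\mathbb R$. Splitting factor: let $\mathbf p,\mathbf q$ be oriented (elliptic) cycles with distinct underlying cycles and normalized matrices $M,N$, and let $\mathbf r\in\mathcal G(\mathbf p,\mathbf q)$. Then $(\mathbf p,\mathbf q;\mathbf r)$ is the unique $\lambda\in\mathbb R\cup\{\infty\}$ such that $\mathbf r$ is represented by $M-\lambda N$ ($\lambda=\infty$ iff $\mathbf r$ and $\mathbf q$ are the same cycle). *)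

(* Defs.v *)
From HB Require Import structures.
From mathcomp Require Import all_boot all_order all_algebra.
From mathcomp Require Import sesquilinear.
From mathcomp Require Import boolp classical_sets reals.
From mathcomp Require Import complex.

Set Implicit Arguments.
Unset Strict Implicit.
Unset Printing Implicit Defensive.

Import Order.TTheory GRing.Theory Num.Theory.

Local Open Scope classical_set_scope.
Local Open Scope ring_scope.
Local Open Scope complex_scope.

Definition real_multiples (R : realType) (M : 'M[R[i]]_2) : set 'M[R[i]]_2 :=
  [set x%:C *: M | x in [set x : R | x != 0]].

(* A generalized cycle is stored as its class modulo nonzero real factors, i.e.
   as the set of all its matrices, so that "=" is equality of generalized
   cycles and [represents r M] says that M is one of the matrices of r. *)
Record gcycle (R : realType) := GCycle {
  represents : set 'M[R[i]]_2 ;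
  gcycleP : exists M : 'M[R[i]]_2,
    [/\ M \is hermsymmx, M != 0 & represents = real_multiples M] }.

(* An oriented cycle is given by its normalized matrix M = (k l; m n): the cycle
   is k z z^* + l z + m z^* + n = 0 and its left half-plane is the set where the
   left-hand side is negative. *)
Record ocycle (R : realType) := OCycle {
  omx :> 'M[R[i]]_2 ;
  omx_herm : omx \is hermsymmx ;
  omx_det : \det omx = -1 }.

Lemma omx_neq0 (R : realType) (p : ocycle R) : omx p != 0.
Proof.
apply/eqP => p0; have := omx_det p; rewrite p0 det0 => /eqP.
by rewrite eq_sym oppr_eq0 oner_eq0.
Qed.

Lemma underlying_subproof (R : realType) (p : ocycle R) :
  exists M : 'M[R[i]]_2,
    [/\ M \is hermsymmx, M != 0 & real_multiples p = real_multiples M].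
Proof. by exists p; split; [exact: omx_herm | exact: omx_neq0 |]. Qed.

Definition underlying (R : realType) (p : ocycle R) : gcycle R :=
  GCycle (underlying_subproof p).

(* The order of R[i] is partial: [z < 0] says that z is real and negative. *)
Definition elliptic (R : realType) (r : gcycle R) : Prop :=
  exists2 M, represents r M & \det M < 0.

Definition pencil (R : realType) (p q : gcycle R) : set (gcycle R) :=
  [set r | exists M N, [/\ represents p M, represents q N &
     exists2 xy : R * R, xy != (0, 0) &
       represents r (xy.1%:C *: M + xy.2%:C *: N)]].

Definition collinear (R : realType) (p q r : gcycle R) : Prop :=
  exists s t : gcycle R,
    [/\ s <> t, pencil s t p, pencil s t q & pencil s t r].

(* R together with one point at infinity, None. *)
Definition proj_line (R : realType) := option R.

(* The undefined product 0 * oo is set to infinity, by convention. *)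
Definition proj_mul (R : realType) (u v : proj_line R) : proj_line R :=
  if (u, v) is (Some x, Some y) then Some (x * y) else None.

Definition is_splitting_factor (R : realType) (p q : ocycle R) (r : gcycle R)
    (lam : proj_line R) : Prop :=
  match lam with
  | Some l => represents r (omx p - l%:C *: omx q)
  | None => r = underlying q
  end.

(* The value is the unique lam with [is_splitting_factor p q r lam] whenever p
   and q have distinct underlying cycles and r lies in their pencil, see
   [splitting_factorP]; otherwise it is irrelevant. *)
Definition splitting_factor (R : realType) (p q : ocycle R) (r : gcycle R) :
    proj_line R :=
  xget (None : option R) [set lam | is_splitting_factor p q r lam].

Lemma represents_neq0 (R : realType) (r : gcycle R) M : represents r M -> M != 0.
Proof.
case: (gcycleP r) => N [_ N0 ->] [x /= x0 <-].
by rewrite scaler_eq0 negb_or N0 andbT (fmorph_eq0 (real_complex R)).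
Qed.

Lemma representsZ (R : realType) (r : gcycle R) M (x : R) :
  represents r M -> x != 0 -> represents r (x%:C *: M).
Proof.
case: (gcycleP r) => N [_ N0 ->] [y /= y0 <-] x0.
by exists (x * y); rewrite /= ?mulf_neq0 // scalerA rmorphM.
Qed.

Lemma represents_prop (R : realType) (r : gcycle R) M N :
  represents r M -> represents r N -> exists2 x : R, x != 0 & N = x%:C *: M.
Proof.
case: (gcycleP r) => K [_ K0 ->] [y /= y0 <-] [z /= z0 <-].
exists (z / y); first by rewrite mulf_neq0 ?invr_eq0.
by rewrite scalerA -rmorphM divfK.
Qed.

Lemma gcycle_eq (R : realType) (r s : gcycle R) M :
  represents r M -> represents s M -> r = s.
Proof.
move=> rM sM; have E : represents r = represents s.
  apply/seteqP; split => N.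
    by move=> /(represents_prop rM)[x x0 ->]; exact: representsZ.
  by move=> /(represents_prop sM)[x x0 ->]; exact: representsZ.
case: r s E {rM sM} => A pA [B pB] /= E.
by case: _ / E pB => pB; congr GCycle; exact: Prop_irrelevance.
Qed.

Lemma represents_underlying (R : realType) (p : ocycle R) :
  represents (underlying p) p.
Proof. by exists 1; rewrite /= ?oner_eq0 // scale1r. Qed.

Lemma splitting_factorP (R : realType) (p q : ocycle R) (r : gcycle R)
    (lam : proj_line R) :
  underlying p <> underlying q -> pencil (underlying p) (underlying q) r ->
  splitting_factor p q r = lam <-> is_splitting_factor p q r lam.
Proof.
move=> pq [_] [_] [] [x /= x0 <-] [y /= y0 <-] [[u v] /=] uv ruv.
have rp := represents_underlying p; have rq := represents_underlying q.
have free (s t : R) : s != 0 -> s%:C *: omx p = t%:C *: omx q -> False.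
  move=> s0 E; apply: pq; apply: (gcycle_eq rp).
  have Ep : omx p = (s^-1 * t)%:C *: omx q.
    by rewrite rmorphM -scalerA -E scalerA -rmorphM mulVf // scale1r.
  rewrite Ep; apply: representsZ => //.
  by apply: contraTneq (omx_neq0 p) => t0; rewrite Ep t0 scale0r eqxx.
have ex : exists l, is_splitting_factor p q r l.
  move: ruv uv; rewrite !scalerA -!rmorphM; case: (eqVneq u 0) => [->|u0] ruv uv.
    exists None; rewrite mul0r scale0r add0r in ruv.
    apply: (gcycle_eq ruv); apply: representsZ => //.
    by rewrite mulf_neq0 //; apply: contraNneq uv => ->.
  have ux0 : u * x != 0 by rewrite mulf_neq0.
  exists (Some (- ((u * x)^-1 * (v * y)))) => /=.
  rewrite rmorphN scaleNr opprK.
  have /(representsZ ruv) : (u * x)^-1 != 0 by rewrite invr_eq0.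
  by rewrite scalerDr !scalerA -!rmorphM mulVf // scale1r.
have uniq l l' : is_splitting_factor p q r l -> is_splitting_factor p q r l' ->
    l = l'.
  have fin m : is_splitting_factor p q r (Some m) -> r <> underlying q.
    move=> /= rm rE; rewrite rE in rm.
    have [z z0 E] := represents_prop rq rm.
    apply: (@free 1 (z + m)); first exact: oner_neq0.
    by rewrite scale1r rmorphD scalerDl -E subrK.
  case: l l' => [l|] [l'|] //.
  - move=> /= h h'; have [z z0 E] := represents_prop h h'.
    have {}E : (1 - z)%:C *: omx p = (l' - z * l)%:C *: omx q.
      rewrite !rmorphB !scalerBl scale1r rmorphM -scalerA.
      move: E; rewrite scalerBr => /eqP; rewrite subr_eq => E.
      apply/eqP; rewrite subr_eq; move: E.
      by rewrite [X in _ == X]addrAC [z%:C *: _ + _]addrC addrAC.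
    case: (eqVneq z 1) E => [->|z1 /free []]; last by rewrite subr_eq0 eq_sym.
    rewrite subrr scale0r mul1r => /esym/eqP.
    rewrite scaler_eq0 (negPf (omx_neq0 q)) orbF (fmorph_eq0 (real_complex R)).
    by rewrite subr_eq0 => /eqP ->.
  - by move=> /fin.
  - by move=> h /fin.
split=> [<-|h]; first by case: ex => l h; exact: (@xgetI _ _ _ l).
by case: ex => l hl; apply: uniq h; exact: (@xgetI _ _ _ l).
Qed.

Lemma elliptic_oriented (R : realType) (r : gcycle R) :
  elliptic r <-> exists p : ocycle R, underlying p = r.
Proof.
split=> [[M rM dM]|[p <-]]; last first.
  exists (omx p); first exact: represents_underlying.
  by rewrite omx_det oppr_lt0 ltr01.
have [d d0 dE] : exists2 d : R, 0 < d & \det M = (- d)%:C.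
  case: (\det M) dM => u v; rewrite ltcE /= => /andP[/eqP <- u0].
  by exists (- u); rewrite ?oppr_gt0 // opprK.
have s0 : (Num.sqrt d)^-1 != 0 by rewrite invr_eq0 gt_eqF ?sqrtr_gt0.
pose N := (Num.sqrt d)^-1%:C *: M.
have rN : represents r N by exact: representsZ.
have hN : N \is hermsymmx.
  case: (gcycleP r) rN => K [hK _ ->] [x _ <-].
  apply/is_hermitianmxP; move/is_hermitianmxP: hK => hK.
  rewrite expr0 scale1r linearZ /= map_mxZ /= {1}hK expr0 scale1r.
  by congr (_ *: _); apply/esym; exact: conjc_real.
have dN : \det N = -1.
  rewrite detZ dE -rmorphXn -rmorphM /= exprVn sqr_sqrtr ?ltW //.
  by rewrite mulrN mulVf ?gt_eqF // rmorphN.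
exists (OCycle hN dN); apply: gcycle_eq rN.
exact: (represents_underlying (OCycle hN dN)).
Qed.

(* Main.v *)
(* Let A, B, C be the normalized matrices of a, b, c; they are linearly
   independent over the reals. The cycles n_a, n_b, n_c have matrices B - l C,
   C - m A and A - n B, where l, m, n are the three splitting factors, and
     (B - l C) + l (C - m A) + l m (A - n B) = (1 - l m n) B,
   so the three matrices are linearly dependent iff l m n = 1. If the oriented
   cycles n_a, n_b have normalized matrices u (B - l C) and v (C - m A), the
   splitting factors in the second identity are - u l / v, - u l and 1 / v. *)

Require Import Defs.
From mathcomp Require Import all_boot all_order all_algebra.
From mathcomp Require Import boolp classical_sets reals.
From mathcomp Require Import sesquilinear complex ring.

Set Implicit Arguments.
Unset Strict Implicit.
Unset Printing Implicit Defensive.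

Import Order.TTheory GRing.Theory Num.Theory.

Local Open Scope classical_set_scope.
Local Open Scope ring_scope.
Local Open Scope complex_scope.

(** Stated on matrices rather than on cycles, so that explicit representatives can be used; by
    [collinearP] their choice is immaterial. *)
Definition real_free3 (R : realType) (M N P : 'M[R[i]]_2) : Prop :=
  forall x y z : R, x%:C *: M + y%:C *: N + z%:C *: P = 0 ->
    [/\ x = 0, y = 0 & z = 0].

Section GeneralizedCycles.
Variable R : realType.
Implicit Types (M N P : 'M[R[i]]_2) (p q r : gcycle R) (x y z : R).

(** * Matrices representing generalized cycles *)

Lemma gcycle_represents p : exists M, represents p M.
Proof.
case: (gcycleP p) => M [_ _ ->]; exists M, 1; last by rewrite scale1r.
by rewrite /= oner_eq0.
Qed.

Lemma gcycle_of_hermitian M : M \is hermsymmx -> M != 0 ->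
  exists p, represents p M.
Proof.
move=> hM M0; have gP : exists N, [/\ N \is hermsymmx, N != 0 &
    real_multiples M = real_multiples N] by exists M.
exists (GCycle gP), 1; last by rewrite scale1r.
by rewrite /= oner_eq0.
Qed.

(** Serves the case of three equal cycles in [collinearP], where a second generator of the pencil
    has to be found. Two different cycles are exhibited, and [p] cannot equal both. *)
Lemma exists_gcycle_neq p : exists q, q <> p.
Proof.
have h1 : (1%:M : 'M[R[i]]_2) \is hermsymmx.
  by apply/is_hermitianmxP; rewrite expr0 scale1r tr_scalar_mx map_mx1.
have hd : (delta_mx 0 0 : 'M[R[i]]_2) \is hermsymmx.
  by apply/is_hermitianmxP; rewrite expr0 scale1r trmx_delta map_delta_mx.
have d0 : (delta_mx 0 0 : 'M[R[i]]_2) != 0.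
  by apply/eqP => /matrixP/(_ 0 0); rewrite !mxE /= => /eqP; rewrite oner_eq0.
have [s sP] := gcycle_of_hermitian h1 (matrix_nonzero1 _ _).
have [t tP] := gcycle_of_hermitian hd d0.
have [sp|//] := pselect (s = p); last by exists s.
exists t => tp; rewrite sp in sP; rewrite tp in tP.
have [x x0 /matrixP/(_ 1 1)] := represents_prop tP sP.
by rewrite !mxE /= mulr0 => /eqP; rewrite oner_eq0.
Qed.

Lemma represents_scaleC_eq0 p M x : represents p M -> x%:C *: M = 0 -> x = 0.
Proof.
move=> pM /eqP; rewrite scaler_eq0 (negPf (represents_neq0 pM)) orbF.
by rewrite (fmorph_eq0 (real_complex R)) => /eqP.
Qed.

Lemma gcycle_neqP p q M N : represents p M -> represents q N ->
  p <> q <-> forall x y, x%:C *: M + y%:C *: N = 0 -> x = 0 /\ y = 0.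
Proof.
move=> pM qN; split=> [pq x y E|free pq].
  have [x0|/eqP x0] := pselect (x = 0).
    split=> //; apply: (represents_scaleC_eq0 qN).
    by rewrite -[RHS]E x0 scale0r add0r.
  have EM : x%:C *: M = (- y)%:C *: N.
    by apply/eqP; rewrite rmorphN scaleNr -addr_eq0 E.
  have rp := representsZ pM x0.
  case: pq; apply: (gcycle_eq rp); rewrite EM; apply: representsZ => //.
  apply: contra_neq (represents_neq0 rp) => y0.
  by rewrite EM y0 scale0r.
rewrite pq in pM; have [x x0 E] := represents_prop pM qN.
have [] := free x (-1); last by move=> x_0; rewrite x_0 eqxx in x0.
by rewrite -E rmorphN rmorph1 scaleN1r subrr.
Qed.

(** * Pencils and collinearity in terms of matrices *)

Lemma pencilE p q r M N : represents p M -> represents q N ->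
  pencil p q r <-> exists x y, represents r (x%:C *: M + y%:C *: N).
Proof.
move=> pM qN; split.
  move=> [M' [N' [pM' qN' [[x y] /= xy0 rxy]]]].
  have [u u0 EM] := represents_prop pM pM'.
  have [v v0 EN] := represents_prop qN qN'.
  by exists (x * u), (y * v); rewrite !rmorphM -!scalerA -EM -EN.
(* The pair is nonzero because the zero matrix represents no cycle. *)
move=> [x [y rxy]]; exists M, N; split=> //; exists (x, y) => //=.
apply: contra_neq (represents_neq0 rxy) => -[-> ->].
by rewrite !scale0r addr0.
Qed.

Lemma pencil_sym p q r : pencil p q r -> pencil q p r.
Proof.
move=> [M [N [pM qN [[x y] /= xy0 rxy]]]].
exists N, M; split=> //; exists (y, x); last by rewrite /= addrC.
by move: xy0; rewrite !xpair_eqE andbC.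
Qed.

Lemma pencil_left p q : pencil p q p.
Proof.
have [[M pM] [N qN]] := (gcycle_represents p, gcycle_represents q).
by apply/(pencilE _ pM qN); exists 1, 0; rewrite scale1r scale0r addr0.
Qed.

Lemma pencil_right p q : pencil p q q.
Proof. exact/pencil_sym/pencil_left. Qed.

(** Two homogeneous linear equations in three unknowns; this makes any three members of one pencil
    dependent. *)
Lemma exists_orthogonal_triple (u1 v1 u2 v2 u3 v3 : R) : exists x y z,
  [/\ ~ [/\ x = 0, y = 0 & z = 0],
      x * u1 + y * u2 + z * u3 = 0 & x * v1 + y * v2 + z * v3 = 0].
Proof.
have [E|D] := eqVneq (u1 * v2) (v1 * u2); last first.
  (* The cross product of the two coefficient vectors; by [D] its last coordinate is nonzero. *)
  exists (u2 * v3 - v2 * u3), (u3 * v1 - v3 * u1), (u1 * v2 - v1 * u2).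
  split; [|by ring|by ring].
  by case=> _ _ /eqP; rewrite subr_eq0 (negPf D).
(* Here the first two columns are proportional, so a relation between them alone suffices. *)
have [u0|u0] := eqVneq u1 0; last first.
  exists u2, (- u1), 0; split; [|by ring|].
    by case=> _ /eqP; rewrite oppr_eq0 (negPf u0).
  by rewrite mul0r addr0 mulNr E; ring.
have [v0|v0] := eqVneq v1 0; last first.
  exists v2, (- v1), 0; split; [| |by ring].
    by case=> _ /eqP; rewrite oppr_eq0 (negPf v0).
  by rewrite mul0r addr0 mulNr -E; ring.
exists 1, 0, 0; split; [|by rewrite u0; ring|by rewrite v0; ring].
by case=> /eqP; rewrite oner_eq0.
Qed.

Lemma collinearP p q r M N P :
  represents p M -> represents q N -> represents r P ->
  collinear p q r <-> ~ real_free3 M N P.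
Proof.
move=> pM qN rP; split.
  move=> [s [t [_ hp hq hr]]].
  have [[S sS] [T tT]] := (gcycle_represents s, gcycle_represents t).
  have coord k K : pencil s t k -> represents k K ->
      exists x y, K = x%:C *: S + y%:C *: T.
    move=> /(pencilE _ sS tT)[x [y rk]] kK.
    have [u u0 ->] := represents_prop rk kK; exists (u * x), (u * y).
    by rewrite scalerDr !scalerA !rmorphM.
  have [u1 [v1 ->]] := coord _ _ hp pM.
  have [u2 [v2 ->]] := coord _ _ hq qN.
  have [u3 [v3 ->]] := coord _ _ hr rP.
  have [x [y [z [xyz0 Eu Ev]]]] := exists_orthogonal_triple u1 v1 u2 v2 u3 v3.
  move=> free; apply/xyz0/free.
  transitivity ((x * u1 + y * u2 + z * u3)%:C *: S +
                (x * v1 + y * v2 + z * v3)%:C *: T).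
    rewrite !rmorphD !rmorphM !scalerDl !scalerDr !scalerA.
    by rewrite (addrACA (_ *: S)) (addrACA (_ + _)).
  by rewrite Eu Ev !scale0r addr0.
move=> dep; have [pq|pq] := pselect (p = q); last first.
  exists p, q; split=> //; [exact: pencil_left|exact: pencil_right|].
  apply: contrapT => npr; apply: dep => x y z E.
  (* A nonzero [z] would allow solving for [P], placing [r] in the pencil of [p] and [q]. *)
  have z0 : z = 0.
    apply: contrapT => /eqP z0; apply: npr; apply/(pencilE _ pM qN).
    exists x, y; move/eqP: E; rewrite addr_eq0 => /eqP ->.
    by rewrite -scaleNr -rmorphN; apply: representsZ; rewrite ?oppr_eq0.
  rewrite z0 scale0r addr0 in E.
  by have [-> ->] := (gcycle_neqP pM qN).1 pq _ _ E.
(* With [p = q], the pencil through [p] and [r] works, or one through [p] and an auxiliary cycle if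
   [r] coincides too. *)
rewrite -{q qN}pq; have [<-|pr] := pselect (p = r).
  have [t tp] := exists_gcycle_neq p; exists t, p.
  by split=> //; exact: pencil_right.
by exists p, r; split=> //; [exact: pencil_left..|exact: pencil_right].
Qed.

(** * Existence and computation of splitting factors *)

Lemma splitting_factor_eq (p q : ocycle R) r lam :
  underlying p <> underlying q -> is_splitting_factor p q r lam ->
  splitting_factor p q r = lam.
Proof.
move=> pq h; apply/(splitting_factorP _ pq) => //.
have [pp qq] := (represents_underlying p, represents_underlying q).
case: lam h => [l /= rl|/= ->]; last exact: pencil_right.
apply/(pencilE _ pp qq); exists 1, (- l).
by rewrite scale1r rmorphN scaleNr.
Qed.

Lemma splitting_factor_finite (p q : ocycle R) r :
  pencil (underlying p) (underlying q) r -> r <> underlying q ->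
  exists l : R, is_splitting_factor p q r (Some l).
Proof.
have [pp qq] := (represents_underlying p, represents_underlying q).
move=> /(pencilE _ pp qq)[x [y rxy]] rq.
(* A zero coefficient of [p] would make [r] the cycle [q]; otherwise dividing by [x] normalizes the
   matrix to [p - l q]. *)
have x0 : x != 0.
  apply/eqP => x0; rewrite x0 scale0r add0r in rxy; apply: rq.
  have y0 : y != 0.
    by apply: contra_neq (represents_neq0 rxy) => ->; rewrite scale0r.
  by apply: (gcycle_eq rxy); exact: representsZ.
exists (- (x^-1 * y)) => /=; rewrite rmorphN scaleNr opprK.
have /(representsZ rxy) : x^-1 != 0 by rewrite invr_eq0.
by rewrite scalerDr !scalerA -!rmorphM mulVf // scale1r.
Qed.

(** * Consequences of independence and the Menelaus relation *)

Lemma real_free3_neq p q r M N P :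
  represents p M -> represents q N -> represents r P -> real_free3 M N P ->
  [/\ p <> q, q <> r & p <> r].
Proof.
move=> pM qN rP free; split.
- apply/(gcycle_neqP pM qN) => x y E.
  by have [] := free x y 0; rewrite // scale0r addr0.
- apply/(gcycle_neqP qN rP) => x y E.
  by have [] := free 0 x y; rewrite // scale0r add0r.
- apply/(gcycle_neqP pM rP) => x y E.
  by have [] := free x 0 y; rewrite // scale0r addr0.
Qed.

Lemma real_free3_menelaus A B C (l m n : R) : real_free3 A B C ->
  ~ real_free3 (B - l%:C *: C) (C - m%:C *: A) (A - n%:C *: B) <->
  l * m * n = 1.
Proof.
move=> free; split=> [dep|lmn].
  apply: contrapT => lmn; apply: dep => x y z E.
  (* These are the coefficients of [A], [B], [C]. The system is cyclic: substituting around it gives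
     [x = x * (l * m * n)]. *)
  have [Ea Eb Ec] : [/\ z - y * m = 0, x - z * n = 0 & y - x * l = 0].
    apply: free; rewrite -[RHS]E.
    by apply/matrixP => i j; rewrite !mxE; ring.
  have {}Ea : z = y * m by apply/subr0_eq.
  have {}Eb : x = z * n by apply/subr0_eq.
  have {}Ec : y = x * l by apply/subr0_eq.
  have x0 : x = 0.
    apply/eqP; apply: contrapT => /negP x0; apply: lmn; apply: (mulfI x0).
    by rewrite mulr1 {2}Eb Ea Ec !mulrA.
  by rewrite Ea Ec x0 !mul0r.
move=> /(_ 1 l (l * m)) [].
  transitivity ((1 - l * m * n)%:C *: B).
    by apply/matrixP => i j; rewrite !mxE; ring.
  by rewrite lmn subrr scale0r.
by move=> /eqP; rewrite oner_eq0.
Qed.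

End GeneralizedCycles.

Theorem theorem11p2 (R : realType) (a b c : ocycle R) (na nb nc : gcycle R)
    (hab : a <> b) (hbc : b <> c) (hac : a <> c)
    (habc : ~ collinear (underlying a) (underlying b) (underlying c))
    (hna : pencil (underlying b) (underlying c) na)
    (hnb : pencil (underlying a) (underlying c) nb)
    (hnc : pencil (underlying a) (underlying b) nc)
    (hna' : [/\ na <> underlying a, na <> underlying b & na <> underlying c])
    (hnb' : [/\ nb <> underlying a, nb <> underlying b & nb <> underlying c])
    (hnc' : [/\ nc <> underlying a, nc <> underlying b & nc <> underlying c]) :
  (collinear na nb nc <->
     proj_mul (proj_mul (splitting_factor b c na) (splitting_factor c a nb))
              (splitting_factor a b nc) = Some 1%R) /\
  (collinear na nb nc -> elliptic na -> elliptic nb ->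
     forall oa ob : ocycle R, underlying oa = na -> underlying ob = nb ->
       splitting_factor oa ob nc =
         proj_mul (splitting_factor oa c (underlying b)) (splitting_factor c ob (underlying a))).
Proof.
have [ra rb rc] := And3 (represents_underlying a) (represents_underlying b)
  (represents_underlying c).
have free : real_free3 (omx a) (omx b) (omx c).
  by apply: contrapT => /(collinearP ra rb rc).
have [ab bc ac] := real_free3_neq ra rb rc free.
(* These three inequalities make the factors finite, so [proj_mul] never meets infinity. *)
have [_ _ nac] := hna'; have [nba _ nbc] := hnb'; have [_ ncb _] := hnc'.
have [l hl] := splitting_factor_finite hna nac.
have [m hm] := splitting_factor_finite (pencil_sym hnb) nba.
have [n hn] := splitting_factor_finite hnc ncb.
have collE : collinear na nb nc <-> l * m * n = 1.
  apply: iff_trans (real_free3_menelaus l m n free).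
  exact: (collinearP hl hm hn).
rewrite (splitting_factor_eq bc hl) (splitting_factor_eq (nesym ac) hm).
rewrite (splitting_factor_eq ab hn); split.
  by rewrite /proj_mul; split=> [/collE ->|[] /collE].
move=> /collE lmn _ _ oa ob oaE obE.
have lmn0 : l * m * n != 0 by rewrite lmn oner_eq0.
have [[/andP[l0 m0] n0]] : (l != 0) && (m != 0) /\ n != 0.
  by move: lmn0; rewrite !mulf_eq0 !negb_or => /andP[].
have roa := represents_underlying oa; have rob := represents_underlying ob.
rewrite oaE in roa; rewrite obE in rob.
(* The signs of [u] and [v] account for the arbitrary orientations of [oa] and [ob]. *)
have [u u0 Eu] := represents_prop hl roa.
have [v v0 Ev] := represents_prop hm rob.
have neq_ab : underlying oa <> underlying ob.
  rewrite oaE obE; apply/(gcycle_neqP hl hm) => x y E.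
  (* The coefficient of [b] is [x] alone; once it vanishes, that of [c] is [y]. *)
  have [_ x0 Ec] : [/\ - (y * m) = 0, x = 0 & y - x * l = 0].
    apply: free; rewrite -[RHS]E.
    by apply/matrixP => i j; rewrite !mxE; ring.
  by move: Ec; rewrite x0 mul0r subr0.
have neq_ac : underlying oa <> underlying c by rewrite oaE.
have neq_cb : underlying c <> underlying ob by rewrite obE; exact: nesym.
(* Adding [u l c] to [u (b - l c)] cancels [c]. *)
rewrite (@splitting_factor_eq _ oa c _ (Some (- (u * l)))) //=; last first.
  have -> : omx oa - (- (u * l))%:C *: omx c = u%:C *: omx b.
    by rewrite Eu; apply/matrixP => i j; rewrite !mxE; ring.
  exact: (representsZ rb u0).
(* Dividing [ob] by [v] gives [c - m a], so the subtraction leaves [m a]. *)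
rewrite (@splitting_factor_eq _ c ob _ (Some v^-1)) //=; last first.
  have -> : omx c - v^-1%:C *: omx ob = m%:C *: omx a.
    rewrite Ev scalerA -rmorphM mulVf // scale1r.
    by rewrite opprB addrC subrK.
  exact: (representsZ ra m0).
(* With this factor [c] cancels, leaving [u b - u l m a], which is [- u l m (a - n b)] exactly
   because [l m n = 1]. *)
rewrite (@splitting_factor_eq _ oa ob _ (Some (- (u * l) / v))) //=.
have -> : omx oa - (- (u * l) / v)%:C *: omx ob =
    (- (u * l * m))%:C *: (omx a - n%:C *: omx b).
  rewrite Ev scalerA -rmorphM divfK // Eu.
  apply/eqP; rewrite -subr_eq0; apply/eqP.
  transitivity ((u * (1 - l * m * n))%:C *: omx b).
    by apply/matrixP => i j; rewrite !mxE; ring.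
  by rewrite lmn subrr mulr0 scale0r.
by apply: representsZ; rewrite // oppr_eq0 !mulf_neq0.
Qed.
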